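(* Let $\mathcal{H}_1,\mathcal{H}_2$ be finite-dimensional Hilbert spaces and let the set of free channels be $\mathcal{O}_{\mathrm{F}}=\bigcup_k\mathcal{O}_{\mathrm{F}_k}\subseteq\mathcal{O}(\mathcal{H}_1\to\mathcal{H}_2)$, where each $\mathcal{O}_{\mathrm{F}_k}$ is convex. For any resource channel $\Lambda\in\mathcal{O}(\mathcal{H}_1\to\mathcal{H}_2)\setminus\mathcal{O}_{\mathrm{F}}$, \[\inf_k\ \max_{\{p_i,\eta_i\}_i,\{M_i\}_i}\frac{p_{\mathrm{succ}}(\Lambda,\{p_i,\eta_i\}_i,\{M_i\}_i)}{\max_{\Xi_k\in\mathcal{O}_{\mathrm{F}_k}}p_{\mathrm{succ}}(\Xi_k,\{p_i,\eta_i\}_i,\{M_i\}_i)}=1+R_{\mathcal{O}_{\mathrm{F}}}(\Lambda).\]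
   Context: $\mathcal{O}(\mathcal{H}_1\to\mathcal{H}_2)$ is the set of quantum channels from operators on $\mathcal{H}_1$ to operators on $\mathcal{H}_2$; $\mathcal{I}_{\mathcal{H}_1}$ is the identity map on operators on $\mathcal{H}_1$. A state ensemble $\{p_i,\eta_i\}_i$ is a finite probability distribution with states $\eta_i$ on $\mathcal{H}_1\otimes\mathcal{H}_1$; $\{M_i\}_i$ is a POVM on $\mathcal{H}_1\otimes\mathcal{H}_2$; for a channel $\Gamma$, $p_{\mathrm{succ}}(\Gamma,\{p_i,\eta_i\}_i,\{M_i\}_i)=\sum_ip_i\operatorname{tr}[M_i(\mathcal{I}_{\mathcal{H}_1}\otimes\Gamma)(\eta_i)]$. The maximum is over all such ensembles and POVMs. The generalized robustness of a channel with respect to a set $\mathcal{G}$ of channels is $R_{\mathcal{G}}(\Lambda)=\min\{s\ge0:\exists\Theta\in\mathcal{O}(\mathcal{H}_1\to\mathcal{H}_2),\ \frac{\Lambda+s\Theta}{1+s}\in\mathcal{G}\}$.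
   Formalization: The maxima and the minimum in the robustness, which need not exist for non-closed free sets, are read as suprema and infimum in the extended reals (infimum of the empty set is infinite); a ratio with zero denominator is infinite, or 0 if the numerator is 0. *)

(* Defs.v *)
From HB Require Import structures.
From mathcomp Require Import all_boot all_order all_algebra.
From mathcomp Require Import complex mxtens.
From mathcomp Require Import classical_sets boolp reals constructive_ereal ereal.
Set Implicit Arguments. Unset Strict Implicit. Unset Printing Implicit Defensive.
Import Order.TTheory GRing.Theory Num.Theory.
Local Open Scope ring_scope.
Local Open Scope classical_set_scope.

Section Quantum.
Variable R : realType.
Local Notation C := (R[i]).

Definition adjmx m n (A : 'M[C]_(m, n)) : 'M[C]_(n, m) := (map_mx (@conjc R) A)^T.

(* positive semidefinite operators (on a complex Hilbert space, this also forces hermiticity) *)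
Definition psd n (A : 'M[C]_n) : Prop :=
  forall v : 'cV[C]_n, 0 <= (adjmx v *m A *m v) 0 0.

Definition density n (A : 'M[C]_n) : Prop := psd A /\ \tr A = 1.

(* block (a,b) of an operator on C^n (x) C^d, w.r.t. the Kronecker ordering of tensmx *)
Definition blk n d (X : 'M[C]_(n * d)) (a b : 'I_n) : 'M[C]_d :=
  \matrix_(i, j) X (mxtens_index (a, i)) (mxtens_index (b, j)).

Definition id_tensor n d1 d2 (G : 'M[C]_d1 -> 'M[C]_d2) (X : 'M[C]_(n * d1))
  : 'M[C]_(n * d2) :=
  \sum_(a < n) \sum_(b < n) (delta_mx a b *t G (blk X a b)).
Arguments id_tensor n {d1 d2}.

Definition linear_map d1 d2 (G : 'M[C]_d1 -> 'M[C]_d2) : Prop :=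
  forall (c : C) (X Y : 'M[C]_d1), G (c *: X + Y) = c *: G X + G Y.

Definition completely_positive d1 d2 (G : 'M[C]_d1 -> 'M[C]_d2) : Prop :=
  forall (n : nat) (X : 'M[C]_(n * d1)), psd X -> psd (id_tensor n G X).

Definition trace_preserving d1 d2 (G : 'M[C]_d1 -> 'M[C]_d2) : Prop :=
  forall X : 'M[C]_d1, \tr (G X) = \tr X.

Definition is_channel d1 d2 (G : 'M[C]_d1 -> 'M[C]_d2) : Prop :=
  [/\ linear_map G, completely_positive G & trace_preserving G].

Definition convex_channels d1 d2 (S : set ('M[C]_d1 -> 'M[C]_d2)) : Prop :=
  forall G1 G2, S G1 -> S G2 -> forall t : R, 0 <= t <= 1 ->
    S (fun X => (real_complex R t) *: G1 X + (real_complex R (1 - t)) *: G2 X).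

Definition is_ensemble d1 m (p : 'I_m -> R) (eta : 'I_m -> 'M[C]_(d1 * d1)) : Prop :=
  [/\ forall i, 0 <= p i, \sum_(i < m) p i = 1 & forall i, density (eta i)].

Definition is_povm n m (M : 'I_m -> 'M[C]_n) : Prop :=
  (forall i, psd (M i)) /\ \sum_(i < m) M i = 1%:M.

Definition psucc d1 d2 (G : 'M[C]_d1 -> 'M[C]_d2) m (p : 'I_m -> R)
  (eta : 'I_m -> 'M[C]_(d1 * d1)) (M : 'I_m -> 'M[C]_(d1 * d2)) : R :=
  \sum_(i < m) p i * @complex.Re R (\tr (M i *m id_tensor d1 G (eta i))).

(* quotient a / b in the extended reals; a vanishing (or undefined) denominator
   gives +oo when the numerator is positive, 0 otherwise *)
Definition eratio (a : R) (b : \bar R) : \bar R :=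
  match b with
  | r%:E => if 0 < r then (a / r)%:E else if 0 < a then +oo%E else 0%E
  | +oo%E => 0%E
  | -oo%E => if 0 < a then +oo%E else 0%E
  end.

Definition max_psucc d1 d2 (S : set ('M[C]_d1 -> 'M[C]_d2)) m (p : 'I_m -> R)
  (eta : 'I_m -> 'M[C]_(d1 * d1)) (M : 'I_m -> 'M[C]_(d1 * d2)) : \bar R :=
  ereal_sup [set (psucc Xi p eta M)%:E | Xi in S].

Definition max_ratio d1 d2 (Lam : 'M[C]_d1 -> 'M[C]_d2) (S : set ('M[C]_d1 -> 'M[C]_d2))
  : \bar R :=
  ereal_sup [set r | exists (m : nat) (p : 'I_m -> R) (eta : 'I_m -> 'M[C]_(d1 * d1))
                       (M : 'I_m -> 'M[C]_(d1 * d2)),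
       [/\ is_ensemble p eta, is_povm M & r = eratio (psucc Lam p eta M) (max_psucc S p eta M)]].

Definition gen_robustness d1 d2 (G : set ('M[C]_d1 -> 'M[C]_d2)) (Lam : 'M[C]_d1 -> 'M[C]_d2)
  : \bar R :=
  ereal_inf [set s%:E | s in [set s : R | 0 <= s /\ exists Th : 'M[C]_d1 -> 'M[C]_d2,
       is_channel Th /\
       G (fun X => (real_complex R (1 + s)^-1) *: (Lam X + (real_complex R s) *: Th X))]].

End Quantum.

(* Main.v *)
(* On the level of Choi operators, the robustness of [Lam] with respect to a
   convex class is the least [t - 1] such that [t X - J(Lam)] is positive for
   some Choi operator [X] of the class. A mixture of [Lam] with some channel
   lying in the class bounds every success ratio. Conversely, apply
   Hahn-Banach to the gauge [p H = inf {t >= 0 | H <= t X for some X}]; the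
   supporting functional at [J(Lam)] is a positive operator [W], and measuring
   the maximally entangled state with a POVM containing a multiple of [W]
   realizes the ratio. As the class need not be closed nor contain invertible
   Choi operators, [p] compares operators only on the support of an [X0] of
   maximal rank, where it is finite; a finite success ratio forces the support
   of [J(Lam)] to lie in that of [X0]. *)

Require Import Defs.
From mathcomp Require Import all_boot all_order all_algebra.
From mathcomp Require Import complex mxtens.
From mathcomp Require Import classical_sets boolp reals constructive_ereal ereal.
From mathcomp Require Import ring lra.
Set Implicit Arguments. Unset Strict Implicit. Unset Printing Implicit Defensive.
Import Order.TTheory GRing.Theory Num.Theory.
Local Open Scope ring_scope.
Local Open Scope classical_set_scope.

(** * Positive semidefinite operators and their quadratic forms *)

Section PositiveOperators.
Context {R : realType}.
Local Notation C := (R[i]).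
Local Notation "x %:C" := (real_complex R x).
Implicit Types m n : nat.

Definition qform n (A : 'M[C]_n) (v : 'cV[C]_n) : C := (adjmx v *m A *m v) 0 0.

Definition sqnorm n (v : 'cV[C]_n) : C := (adjmx v *m v) 0 0.

Lemma adjmxE m n (A : 'M[C]_(m, n)) i j : adjmx A i j = conjc (A j i).
Proof. by rewrite !mxE. Qed.

Lemma adjmxK m n (A : 'M[C]_(m, n)) : adjmx (adjmx A) = A.
Proof. by apply/matrixP => i j; rewrite !adjmxE conjcK. Qed.

Lemma adjmxM m n p (A : 'M[C]_(m, n)) (B : 'M_(n, p)) :
  adjmx (A *m B) = adjmx B *m adjmx A.
Proof. by rewrite /adjmx map_mxM trmx_mul. Qed.

Lemma adjmxD m n (A B : 'M[C]_(m, n)) : adjmx (A + B) = adjmx A + adjmx B.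
Proof. by rewrite /adjmx map_mxD linearD. Qed.

Lemma adjmxZ m n (c : C) (A : 'M[C]_(m, n)) : adjmx (c *: A) = conjc c *: adjmx A.
Proof. by rewrite /adjmx map_mxZ linearZ. Qed.

Lemma adjmxN m n (A : 'M[C]_(m, n)) : adjmx (- A) = - adjmx A.
Proof. by rewrite /adjmx map_mxN linearN. Qed.

Lemma adjmx_delta m n (i : 'I_m) (j : 'I_n) : adjmx (delta_mx i j : 'M[C]_(m, n)) = delta_mx j i.
Proof. by rewrite /adjmx map_delta_mx trmx_delta. Qed.

(** The spectral theorem is stated with [Num.conj], the adjoint here with [conjc]. *)
Lemma conjC_conjc (x : C) : Num.conj x = conjc x.
Proof.
have [->|x0] := eqVneq x 0; first by rewrite conjC0 conjc0.
by apply: (mulfI x0); rewrite -normCK sqr_normc.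
Qed.

Lemma qformD n (A B : 'M[C]_n) v : qform (A + B) v = qform A v + qform B v.
Proof. by rewrite /qform mulmxDr mulmxDl mxE. Qed.

Lemma qformZ n c (A : 'M[C]_n) v : qform (c *: A) v = c * qform A v.
Proof. by rewrite /qform -scalemxAr -scalemxAl mxE. Qed.

Lemma qformN n (A : 'M[C]_n) v : qform (- A) v = - qform A v.
Proof. by rewrite -scaleN1r qformZ mulN1r. Qed.

Lemma qform_congr n m (B : 'M[C]_(n, m)) (A : 'M[C]_m) v :
  qform (B *m A *m adjmx B) v = qform A (adjmx B *m v).
Proof. by rewrite /qform adjmxM adjmxK !mulmxA. Qed.

Lemma sqnormE n (v : 'cV[C]_n) : sqnorm v = \sum_i `|v i 0| ^+ 2.
Proof.
by rewrite /sqnorm mxE; apply: eq_bigr => i _; rewrite adjmxE mulrC -sqr_normc.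
Qed.

Lemma sqnorm_ge0 n (v : 'cV[C]_n) : 0 <= sqnorm v.
Proof. by rewrite sqnormE sumr_ge0// => i _; rewrite exprn_ge0. Qed.

Lemma sqnorm_eq0 n (v : 'cV[C]_n) : sqnorm v = 0 -> v = 0.
Proof.
rewrite sqnormE => /eqP; rewrite psumr_eq0 => [/allP h|i _]; last exact: exprn_ge0.
apply/matrixP => i j; rewrite mxE ord1; apply/eqP.
by have := h i (mem_index_enum i); rewrite /= expf_eq0/= normr_eq0.
Qed.

Lemma qform1 n (v : 'cV[C]_n) : qform 1%:M v = sqnorm v.
Proof. by rewrite /qform mulmx1. Qed.

Lemma qform_gram m n (B : 'M[C]_(m, n)) v : qform (B *m adjmx B) v = sqnorm (adjmx B *m v).
Proof. by rewrite -{1}[B]mulmx1 qform_congr qform1. Qed.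

Lemma psd_gram_mul m n (B : 'M[C]_(m, n)) : psd (B *m adjmx B).
Proof. by move=> v; rewrite -/(qform _ v) qform_gram sqnorm_ge0. Qed.

Lemma psdD n (A B : 'M[C]_n) : psd A -> psd B -> psd (A + B).
Proof. by move=> hA hB v; have := qformD A B v; rewrite /qform => ->; rewrite addr_ge0. Qed.

Lemma psdZ n c (A : 'M[C]_n) : 0 <= c -> psd A -> psd (c *: A).
Proof. by move=> hc hA v; have := qformZ c A v; rewrite /qform => ->; rewrite mulr_ge0. Qed.

Lemma psd_congr n m (B : 'M[C]_(n, m)) (A : 'M[C]_m) : psd A -> psd (B *m A *m adjmx B).
Proof. by move=> hA v; rewrite -/(qform _ _) qform_congr; exact: hA. Qed.

Lemma psd_sum I (r : seq I) n (F : I -> 'M[C]_n) :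
  (forall i, psd (F i)) -> psd (\sum_(i <- r) F i).
Proof.
move=> h; elim/big_ind: _ => //; last exact: psdD.
by move=> v; rewrite mulmx0 mul0mx mxE.
Qed.

Lemma mul_delta_qform n (A : 'M[C]_n) i j :
  (adjmx (delta_mx i 0 : 'cV_n) *m A *m (delta_mx j 0 : 'cV_n)) 0 0 = A i j.
Proof. by rewrite adjmx_delta -rowE -colE !mxE. Qed.

(** Polarization: the form is real at [x + c y] for [c = 1] and [c = i], and the imaginary parts of
    the two expansions relate [A i j] to [A j i]. *)
Lemma psd_hermitian n (A : 'M[C]_n) : psd A -> adjmx A = A.
Proof.
move=> hA; apply/matrixP => i j; rewrite adjmxE.
pose x : 'cV[C]_n := delta_mx j 0; pose y : 'cV[C]_n := delta_mx i 0.
have expand c : qform A (x + c *: y) =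
    qform A x + c * A j i + conjc c * A i j + c * conjc c * qform A y.
  rewrite /qform adjmxD adjmxZ !(mulmxDl, mulmxDr) -!(scalemxAl, scalemxAr).
  have eD (M N : 'M[C]_1) : (M + N) 0 0 = M 0 0 + N 0 0 by rewrite mxE.
  have eZ d (M : 'M[C]_1) : (d *: M) 0 0 = d * M 0 0 by rewrite mxE.
  by rewrite !(eD, eZ) !mul_delta_qform; ring.
have im0 v : complex.Im (qform A v) = 0 by apply: ger0_Im; exact: hA.
have := im0 (x + 1 *: y); have := im0 (x + 'i%C *: y).
rewrite !expand; have := im0 x; have := im0 y.
case: (qform A x) (qform A y) => [a b] [c d] /= -> ->.
case: (A i j) (A j i) => [e f] [g h] /= h1 h2.
by apply/eqP; rewrite eq_complex /=; apply/andP; split; apply/eqP; lra.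
Qed.

(** By the spectral theorem [A] is unitarily diagonalizable; positivity makes the spectrum
    nonnegative, and scaling the eigenvectors by the square roots of the eigenvalues gives [B]. *)
Lemma psd_gram n (A : 'M[C]_n) : psd A -> exists B : 'M[C]_n, A = B *m adjmx B.
Proof.
move=> hA; have tA m p (M : 'M[C]_(m, p)) : map_mx Num.conj M^T = adjmx M.
  by apply/matrixP => i j; rewrite !mxE conjC_conjc.
have nA : A \is normalmx.
  by apply/normalmxP; rewrite tA psd_hermitian.
have /orthomx_spectralP := nA.
set P := spectralmx A; set sp := spectral_diag A => eA.
have uP : P \is unitarymx := spectral_unitarymx A.
have iP : invmx P = adjmx P by rewrite invmx_unitary// tA.
have PP : P *m adjmx P = 1%:M by rewrite -iP mulmxV// spectral_unit.
have sp0 i : 0 <= sp 0 i.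
  have := hA (adjmx P *m delta_mx i 0); rewrite -/(qform _ _) -qform_congr.
  rewrite eA iP !mulmxA PP mul1mx -mulmxA PP mulmx1.
  by rewrite /qform mul_delta_qform mxE eqxx.
pose s : 'rV[C]_n := \row_i sqrtC (sp 0 i).
exists (adjmx P *m diag_mx s); rewrite adjmxM adjmxK.
rewrite {1}eA iP !mulmxA; congr (_ *m _); rewrite -!mulmxA; congr (_ *m _).
apply/matrixP => i j; rewrite mul_diag_mx !mxE.
rewrite eq_sym; case: eqP => [->|_]; last by rewrite !mulr0n conjc0 mulr0.
rewrite !mulr1n -conjC_conjc conj_Creal ?ger0_real ?sqrtC_ge0// -expr2.
by rewrite sqrtCK.
Qed.

Lemma psd_qform_eq0 n (A : 'M[C]_n) v : psd A -> qform A v = 0 -> A *m v = 0.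
Proof.
move=> /psd_gram[B ->]; rewrite qform_gram => /sqnorm_eq0 h.
by rewrite -mulmxA h mulmx0.
Qed.

(** The columns of [cokermx A] lie in the kernel of [A]; there the form of [A], hence that of [B],
    vanishes, and positivity of [B] turns this into [B v = 0]. *)
Lemma psd_submx n (A B : 'M[C]_n) : psd A -> psd B ->
  (forall v, qform A v = 0 -> qform B v = 0) -> (B <= A)%MS.
Proof.
move=> hA hB h; rewrite submxE; apply/eqP.
move: (cokermx A) (mulmx_coker A) => K AK; apply/matrixP => i j.
have -> : (B *m K) i j = (B *m col j K) i 0.
  by rewrite !mxE; apply: eq_bigr => k _; rewrite mxE.
have -> : B *m col j K = 0; last by rewrite !mxE.
apply: psd_qform_eq0 => //; apply: h; rewrite /qform -mulmxA.
by rewrite colE (mulmxA A) AK mul0mx mulmx0 mxE.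
Qed.

Lemma qform_bound n (A : 'M[C]_n) :
  exists2 c : R, 0 < c & forall v, `|qform A v| <= c%:C * sqnorm v.
Proof.
pose S : C := \sum_i \sum_j `|A i j|.
have S0 : 0 <= S by rewrite sumr_ge0// => i _; rewrite sumr_ge0.
exists (1 + complex.Re S) => [|v].
  by move: S0; rewrite lecE => /andP[_ h]; rewrite ltr_pwDl.
have w0 := sqnorm_ge0 v; set w := sqnorm v in w0 *.
apply: (@le_trans _ _ (S * w)); last first.
  rewrite rmorphD/= RRe_real ?ger0_real// rmorph1 mulrDl mul1r.
  by rewrite lerDr.
have vw i : `|v i 0| ^+ 2 <= w.
  by rewrite /w sqnormE (bigD1 i)//= lerDl sumr_ge0// => j _; rewrite exprn_ge0.
have vvw i j : `|v i 0| * `|v j 0| <= w.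
  have r k : `|v k 0| \is Num.real by rewrite normr_real.
  have /orP[h|h] := real_leVge (r i) (r j).
    by apply: le_trans (vw j); rewrite expr2 ler_wpM2r.
  by apply: le_trans (vw i); rewrite expr2 ler_wpM2l.
have -> : qform A v = \sum_i \sum_j conjc (v i 0) * A i j * v j 0.
  rewrite /qform mxE exchange_big; apply: eq_bigr => j _.
  by rewrite mxE mulr_suml; apply: eq_bigr => i _; rewrite adjmxE.
rewrite (le_trans (ler_norm_sum _ _ _))// /S mulr_suml ler_sum// => i _.
rewrite (le_trans (ler_norm_sum _ _ _))// mulr_suml ler_sum// => j _.
by rewrite !normrM normcJ mulrAC mulrC ler_wpM2l.
Qed.

Lemma psd_qform_bound n (A : 'M[C]_n) : psd A ->
  exists2 c : R, 0 < c & forall v, qform A v <= c%:C * sqnorm v.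
Proof.
move=> hA; have [c c0 hc] := qform_bound A; exists c => // v.
by apply: le_trans (hc v); apply/real_ler_norm/ger0_real/hA.
Qed.

End PositiveOperators.

(** * Sublinear functionals and a finite-dimensional Hahn-Banach theorem *)

Section RealSublinear.
Context {R : realType}.
Local Notation C := (R[i]).
Local Notation "x %:C" := (real_complex R x).

(** Homogeneity concerns nonnegative real scalars only: the complex space is treated as a real
    one. *)
Definition sublinear (V : lmodType C) (p : V -> R) :=
  (forall x y, p (x + y) <= p x + p y) /\
  (forall t x, 0 <= t -> p (t%:C *: x) = t * p x).

Section Linearization.
Variable V : lmodType C.
Implicit Types (p q : V -> R) (x y v : V).

Lemma sublinear0 p : sublinear p -> p 0 = 0.
Proof. by case=> _ h; have := h 0 0 (lexx _); rewrite scaler0 mul0r. Qed.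

Lemma sublinear_oppr p x : sublinear p -> - p x <= p (- x).
Proof. by move=> hp; have := hp.1 x (- x); rewrite subrr sublinear0//; lra. Qed.

(* The gauge [x |-> inf_(t >= 0) p (x + t v) - t p v] is linear along [v]. *)
Lemma sublinear_along p v : sublinear p ->
  exists q, [/\ sublinear q, forall x, q x <= p x & q (- v) <= - p v].
Proof.
move=> hp; have [pD pZ] := hp.
pose E x := [set y | exists2 t : R, 0 <= t & y = p (x + t%:C *: v) - t * p v].
have E0 x : E x !=set0 by exists (p (x + 0%:C *: v) - 0 * p v); exists 0.
(* Subadditivity at [x + t v] and [- x] bounds the set below, so its infimum is meaningful. *)
have lbE x : lbound (E x) (- p (- x)).
  move=> _ [t t0 ->]; rewrite -(pZ t)//.
  by have := pD (x + t%:C *: v) (- x); rewrite addrAC subrr add0r; lra.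
have ltE x t : 0 <= t -> inf (E x) <= p (x + t%:C *: v) - t * p v.
  by move=> t0; apply: ge_inf; [exists (- p (- x)); exact: lbE | exists t].
have geE x z : (forall t, 0 <= t -> z <= p (x + t%:C *: v) - t * p v) -> z <= inf (E x).
  by move=> h; apply: lb_le_inf => // _ [t t0 ->]; exact: h.
have scale_le c x : 0 < c -> inf (E (c%:C *: x)) <= c * inf (E x).
  move=> c0; rewrite -ler_pdivrMl//; apply: (geE) => t t0.
  rewrite ler_pdivrMl//; apply: le_trans (ltE _ (c * t) _) _; first by rewrite mulr_ge0// ltW.
  by rewrite rmorphM -scalerA -scalerDr (pZ _ _ (ltW c0)) mulrBr mulrA.
exists (fun x => inf (E x)); split.
- split=> [x y|c x].
    rewrite -lerBlDr; apply: (geE) => t t0.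
    rewrite lerBlDr -lerBlDl; apply: (geE) => s s0.
    rewrite lerBlDl; apply: le_trans (ltE _ (t + s) (addr_ge0 t0 s0)) _.
    rewrite rmorphD scalerDl.
    have := pD (x + t%:C *: v) (y + s%:C *: v).
    by rewrite addrACA; lra.
  rewrite le_eqVlt => /predU1P[<-|c0].
    rewrite scale0r mul0r; apply/eqP; rewrite eq_le; apply/andP; split.
      by have := ltE 0 0 (lexx _); rewrite scale0r addr0 sublinear0//; lra.
    by apply: (geE) => t t0; rewrite add0r pZ// subrr.
  apply/eqP; rewrite eq_le scale_le//=.
  rewrite -ler_pdivlMl//.
  have := scale_le c^-1 (c%:C *: x).
  rewrite scalerA -rmorphM mulVf ?gt_eqF// rmorph1 scale1r invr_gt0; exact.
- by move=> x; have := ltE x 0 (lexx _); rewrite scale0r addr0; lra.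
- by have := ltE (- v) 1 ler01; rewrite scale1r addNr sublinear0//; lra.
Qed.

(** Linearizing along one vector after another keeps what was gained: for sublinear [q <= p1], [- q
    v <= q (- v) <= p1 (- v) <= - p v <= - q v]. *)
Lemma sublinear_odd_seq p (s : seq V) : sublinear p ->
  exists q, [/\ sublinear q, forall x, q x <= p x & {in s, forall v, q (- v) = - q v}].
Proof.
elim: s p => [|v s IH] p hp; first by exists p.
have [p1 [hp1 le1 odd1]] := sublinear_along v hp.
have [q [hq le2 odd2]] := IH _ hp1.
exists q; split=> // [x|x]; first exact: le_trans (le2 _) (le1 _).
rewrite inE => /predU1P[->|]; last exact: odd2.
have := sublinear_oppr v hq; have := le2 (- v); have := le2 v; have := le1 v; lra.
Qed.

(** The vectors at which [q] is odd form a real subspace on which [q] is linear; this and the two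
    lemmas below establish that. *)
Lemma sublinear_oddD q x y : sublinear q -> q (- x) = - q x -> q (- y) = - q y ->
  q (x + y) = q x + q y /\ q (- (x + y)) = - q (x + y).
Proof.
move=> hq ox oy; have := hq.1 x y; have := hq.1 (- x) (- y).
have := sublinear_oppr (x + y) hq; rewrite -opprD ox oy => h1 h2 h3; split; lra.
Qed.

Lemma sublinear_oddZ q (t : R) x : sublinear q -> q (- x) = - q x ->
  q (t%:C *: x) = t * q x /\ q (- (t%:C *: x)) = - q (t%:C *: x).
Proof.
move=> [_ qZ] ox; have [t0|t0] := leP 0 t.
  by rewrite -scalerN !qZ// ox mulrN.
have e : t%:C *: x = (- t)%:C *: - x by rewrite scalerN rmorphN scaleNr opprK.
have nt : 0 <= - t by lra.
rewrite e -scalerN opprK !qZ// ox; split; lra.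
Qed.

Lemma sublinear_odd_sum q I (r : seq I) (F : I -> V) : sublinear q ->
  (forall i, q (- F i) = - q (F i)) ->
  q (\sum_(i <- r) F i) = \sum_(i <- r) q (F i) /\
  q (- \sum_(i <- r) F i) = - q (\sum_(i <- r) F i).
Proof.
move=> hq oF; elim: r => [|i r [IH1 IH2]].
  by rewrite !big_nil oppr0 sublinear0// oppr0.
by rewrite !big_cons -IH1; exact: sublinear_oddD.
Qed.

End Linearization.

Lemma complexRe_sum I (r : seq I) (F : I -> C) :
  complex.Re (\sum_(i <- r) F i) = \sum_(i <- r) complex.Re (F i).
Proof. by apply: (big_morph (@complex.Re R)) => // -[? ?] [? ?]. Qed.

(** Finite dimension spares Zorn's lemma: linearizing [p] along [A0] and then along the real basis
    [b] leaves a real-linear minorant [q], and the first step forces [q A0 = p A0]. *)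
Lemma hahn_banach_mx n (p : 'M[C]_n -> R) (A0 : 'M[C]_n) : sublinear p ->
  exists2 W : 'M[C]_n, (forall A, complex.Re (\tr (W *m A)) <= p A) &
    complex.Re (\tr (W *m A0)) = p A0.
Proof.
move=> hp; have [p1 [hp1 le1 odd1]] := sublinear_along A0 hp.
pose b (k : bool * ('I_n * 'I_n)) : 'M[C]_n :=
  (if k.1 then 'i%C else 1) *: delta_mx k.2.1 k.2.2.
have [q [hq le2 odd2]] := sublinear_odd_seq (codom b) hp1.
have oddb k : q (- b k) = - q (b k) by apply: odd2; rewrite codom_f.
(* The transposed indices come from the trace, and the minus sign makes the real part of
   [W i j * A j i] pair the imaginary parts with a plus. *)
pose W : 'M[C]_n := \matrix_(i, j) Complex (q (b (false, (j, i)))) (- q (b (true, (j, i)))).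
have decomp (A : 'M[C]_n) : A = \sum_i \sum_j
    ((complex.Re (A i j))%:C *: b (false, (i, j)) + (complex.Im (A i j))%:C *: b (true, (i, j))).
  rewrite [LHS]matrix_sum_delta; apply: eq_bigr => i _; apply: eq_bigr => j _.
  by rewrite /b /= scale1r scalerA -scalerDl mulrC -complexE.
have oddRe i j (A : 'M[C]_n) k : q (- ((complex.Re (A i j))%:C *: b k)) = - q ((complex.Re (A i j))%:C *: b k).
  by case: (sublinear_oddZ (complex.Re (A i j)) hq (oddb k)).
have oddIm i j (A : 'M[C]_n) k : q (- ((complex.Im (A i j))%:C *: b k)) = - q ((complex.Im (A i j))%:C *: b k).
  by case: (sublinear_oddZ (complex.Im (A i j)) hq (oddb k)).
have odd_entry i j (A : 'M[C]_n) := sublinear_oddD hq (oddRe i j A (false, (i, j))) (oddIm i j A (true, (i, j))).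
have odd_row i (A : 'M[C]_n) := sublinear_odd_sum (index_enum 'I_n) hq (fun j => (odd_entry i j A).2).
have qE A : complex.Re (\tr (W *m A)) = q A.
  rewrite [in RHS](decomp A) (sublinear_odd_sum _ hq (fun i => (odd_row i A).2)).1.
  rewrite /mxtrace complexRe_sum.
  under eq_bigr do rewrite mxE complexRe_sum.
  rewrite exchange_big; apply: eq_bigr => i _.
  rewrite (odd_row i A).1; apply: eq_bigr => j _.
  rewrite (odd_entry i j A).1 !(sublinear_oddZ _ hq (oddb _)).1 mxE.
  case: (A i j) => a c /=; lra.
exists W => [A|]; rewrite qE; first exact: le_trans (le2 _) (le1 _).
have := le1 A0; have := le2 A0; have := le2 (- A0); have := sublinear_oppr A0 hq; lra.
Qed.

End RealSublinear.

(** * Convex sets of positive operators and their supports *)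

Section ConeDuality.
Context {R : realType}.
Local Notation C := (R[i]).
Local Notation "x %:C" := (real_complex R x).

Lemma complexReZ (t : R) (x : C) : complex.Re (t%:C * x) = t * complex.Re x.
Proof. by case: x => a b /=; rewrite mul0r subr0. Qed.

Lemma complexReD (x y : C) : complex.Re (x + y) = complex.Re x + complex.Re y.
Proof. by case: x y => [? ?] [? ?]. Qed.

Lemma complexReN (x : C) : complex.Re (- x) = - complex.Re x.
Proof. by case: x. Qed.

Lemma complexRe_ge0 (x : C) : 0 <= x -> 0 <= complex.Re x.
Proof. by rewrite lecE => /andP[_]. Qed.

Lemma complexRe_le (x y : C) : x <= y -> complex.Re x <= complex.Re y.
Proof. by rewrite lecE => /andP[_]. Qed.

Lemma ge0_complexE (x : C) : 0 <= x -> x = (complex.Re x)%:C.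
Proof. by move=> x0; rewrite RRe_real ?ger0_real. Qed.

Lemma psd_of_Re n (A : 'M[C]_n) : adjmx A = A ->
  (forall v, 0 <= complex.Re (qform A v)) -> psd A.
Proof.
move=> hA h v; have := h v; rewrite -/(qform A v).
have : conjc (qform A v) = qform A v.
  by rewrite -adjmxE /qform !adjmxM adjmxK hA mulmxA.
case: (qform A v) => a b [] hb; rewrite lecE /= => ->; rewrite andbT; apply/eqP; lra.
Qed.

Lemma mxtrace_mul_rank1 n (W : 'M[C]_n) (v : 'cV_n) : \tr (W *m (v *m adjmx v)) = qform W v.
Proof. by rewrite mulmxA mxtrace_mulC mulmxA /mxtrace big_ord1. Qed.

Lemma qform_rank1 n (v w : 'cV[C]_n) : qform (v *m adjmx v) w = `|(adjmx v *m w) 0 0| ^+ 2.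
Proof.
by rewrite qform_gram sqnormE big_ord1.
Qed.

Definition mx_convex n (T : set 'M[C]_n) := forall X Y (t : R), T X -> T Y ->
  0 <= t <= 1 -> T (t%:C *: X + (1 - t)%:C *: Y).

Lemma mx_convex_cone n (T : set 'M[C]_n) X Y (t s : R) : mx_convex T -> T X -> T Y ->
  0 <= t -> 0 <= s -> exists2 Z, T Z & (t + s)%:C *: Z = t%:C *: X + s%:C *: Y.
Proof.
move=> cT TX TY t0 s0; have [ts0|ts0] := eqVneq (t + s) 0.
  have [-> ->] : t = 0 /\ s = 0 by split; lra.
  by exists X => //; rewrite addr0 !scale0r addr0.
have ts_gt0 : 0 < t + s by rewrite lt0r ts0 addr_ge0.
exists ((t / (t + s))%:C *: X + (1 - t / (t + s))%:C *: Y).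
  by apply: cT => //; rewrite divr_ge0 ?addr_ge0//= ler_pdivrMr// mul1r lerDl.
have e1 : (t + s) * (t / (t + s)) = t by rewrite mulrCA divff// mulr1.
have e2 : (t + s) * (1 - t / (t + s)) = s by rewrite mulrBr e1; ring.
by rewrite scalerDr !scalerA -!rmorphM e1 e2.
Qed.

Lemma ex_max_rank n (T : set 'M[C]_n) : T !=set0 ->
  exists2 X0, T X0 & forall X, T X -> (\rank X <= \rank X0)%N.
Proof.
move=> [X TX]; pose P r := `[< exists2 Y, T Y & \rank Y = r >].
have exP : exists r, P r by exists (\rank X); apply/asboolP; exists X.
have ubP r : P r -> (r <= n)%N by move=> /asboolP[Y _ <-]; exact: rank_leq_row.
case: (ex_maxnP exP ubP) => r /asboolP[X0 TX0 <-] h; exists X0 => // Y TY.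
by apply: h; apply/asboolP; exists Y.
Qed.

(** The midpoint [M] of [X0] and [X] has its kernel inside both kernels, so its row space contains
    both; as [X0] has maximal rank, the row spaces of [M] and [X0] agree. *)
Lemma mx_convex_max_rank n (T : set 'M[C]_n) X0 : mx_convex T -> (forall X, T X -> psd X) ->
  T X0 -> (forall X, T X -> (\rank X <= \rank X0)%N) -> forall X, T X -> (X <= X0)%MS.
Proof.
move=> cT pT TX0 maxr X TX.
pose M := (2^-1)%:C *: X0 + (1 - 2^-1)%:C *: X.
have TM : T M by apply: cT => //; apply/andP; split; lra.
have ge0 Y v : T Y -> 0 <= qform Y v by move=> TY; exact: (pT Y TY).
have qM v : qform M v = 0 -> qform X0 v = 0 /\ qform X v = 0.
  rewrite qformD !qformZ => /eqP.
  have h1 : 0 < (2^-1 : R)%:C by rewrite -[0]/(0%:C) ltcR; lra.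
  have h2 : 0 < (1 - 2^-1 : R)%:C by rewrite -[0]/(0%:C) ltcR; lra.
  rewrite paddr_eq0 ?(mulr_ge0 (ltW h1) (ge0 _ v TX0)) ?(mulr_ge0 (ltW h2) (ge0 _ v TX))//.
  by rewrite !mulf_eq0 (gt_eqF h1) (gt_eqF h2) => /andP[/eqP-> /eqP->].
have sX0 : (X0 <= M)%MS.
  by apply: psd_submx => [||v /qM[]]; [exact: pT|exact: pT|].
have sX : (X <= M)%MS by apply: psd_submx => [||v /qM[]]; [exact: pT|exact: pT|].
apply: submx_trans sX _.
by have [_ /esym] := mxrank_leqif_sup sX0; rewrite eqn_leq mxrankS// maxr// => ->.
Qed.

(** Writing [A = B B^*], the vector on the left is a fixed matrix applied to [B^* v], whose squared
    norm is [qform A v]. *)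
Lemma psd_qform_pinv_bound n (A : 'M[C]_n) : psd A -> exists2 c : R, 0 < c &
  forall v, sqnorm (pinvmx A *m A *m v) <= c%:C * qform A v.
Proof.
move=> /psd_gram[B eB]; pose Z := pinvmx A *m B.
have [c c0 hc] := psd_qform_bound (psd_gram_mul (adjmx Z)); exists c => // v.
rewrite [in qform A v]eB qform_gram; move: (hc (adjmx B *m v)).
rewrite qform_gram adjmxK mulmxA.
by have -> : Z *m adjmx B = pinvmx A *m A by rewrite {2}eB mulmxA.
Qed.

(** * Duality between a convex set of positive operators and its normalized witnesses *)

Section Duality.
Variables (n : nat) (T : set 'M[C]_n) (L : 'M[C]_n) (rho : R).
Hypotheses (T_convex : mx_convex T) (T_psd : forall X, T X -> psd X) (L_psd : psd L).
Hypothesis dual_bound : forall W, psd W ->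
  (forall X, T X -> complex.Re (\tr (W *m X)) <= 1) -> complex.Re (\tr (W *m L)) <= rho.

(** For [v] in the kernel of [X0], hence of every [X] in [T], all multiples [k v v^*] are admissible
    witnesses, so [k] times the form of [L] at [v] stays below [rho] for every [k >= 0]. *)
Lemma dual_bound_submx X0 : T X0 -> (forall X, T X -> (X <= X0)%MS) -> (L <= X0)%MS.
Proof.
move=> TX0 sX; apply: psd_submx => // [|v v0]; first exact: T_psd.
have X0v : X0 *m v = 0 by apply: psd_qform_eq0 => //; exact: T_psd.
have Xv X : T X -> qform X v = 0.
  by move=> /sX/submxP[D ->]; rewrite /qform -!mulmxA X0v !mulmx0 mxE.
have key (k : R) : 0 <= k -> k * complex.Re (qform L v) <= rho.
  move=> k0; pose W := k%:C *: (v *m adjmx v).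
  have trW X : complex.Re (\tr (W *m X)) = k * complex.Re (qform X v).
    by rewrite -scalemxAl mxtraceZ complexReZ mxtrace_mulC mxtrace_mul_rank1.
  rewrite -trW; apply: dual_bound => [|X TX].
    by apply: psdZ; [rewrite ler0c|exact: psd_gram_mul].
  by rewrite trW Xv// mulr0 ler01.
have Lv := L_psd v; rewrite -/(qform L v) in Lv.
rewrite (ge0_complexE Lv); have := complexRe_ge0 Lv.
rewrite le_eqVlt => /predU1P[<-//|r0].
have k0 : 0 <= (`|rho| + 1) / complex.Re (qform L v).
  by rewrite divr_ge0 ?addr_ge0 ?(ltW r0).
have := key _ k0; rewrite divfK ?gt_eqF// leNgt.
by rewrite (le_lt_trans (ler_norm rho))// ltrDl.
Qed.

(** The gauge of [L] is at most [rho] by Hahn-Banach; [delta] is there because its infimum need not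
    be attained. *)
Lemma cone_duality (delta : R) : T !=set0 -> 0 < delta ->
  exists X (t : R), [/\ T X, 0 <= t, t <= rho + delta & psd (t%:C *: X - L)].
Proof.
move=> T0 delta0; have [X0 TX0 maxX0] := ex_max_rank T0.
have sX := mx_convex_max_rank T_convex T_psd TX0 maxX0.
have sL := dual_bound_submx TX0 sX.
(* A projection, possibly oblique, along the kernel of [X0]; by [PK], positive operators supported
   on [X0] do not see it. *)
pose P := pinvmx X0 *m X0.
have PK A v : psd A -> (A <= X0)%MS -> qform A (P *m v) = qform A v.
  move=> hA sA; have AP : A *m P = A by rewrite mulmxA mulmxKpV.
  have PAP : adjmx P *m A *m P = A.
    by rewrite -mulmxA AP -{1}(psd_hermitian hA) -adjmxM AP psd_hermitian.
  by rewrite -{1}[P]adjmxK -qform_congr adjmxK PAP.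
pose re A v := complex.Re (qform A (P *m v)).
have reD A B v : re (A + B) v = re A v + re B v by rewrite /re qformD complexReD.
have reZ (t : R) A v : re (t%:C *: A) v = t * re A v by rewrite /re qformZ complexReZ.
have re_ge0 X v : T X -> 0 <= re X v by move=> TX; apply/complexRe_ge0/T_psd.
(* Evaluating at [P v] compares an arbitrary [H] with [T] on the support only, and real parts avoid
   requiring [H] hermitian. *)
pose E H := [set t : R | 0 <= t /\ exists2 X, T X & forall v, re H v <= t * re X v].
(* The form of [H] at [P v] is at most [d] times the squared norm of [P v], itself at most [c] times
   the form of [X0] at [v]. *)
have E_neq0 H : E H !=set0.
  have [c c0 hc] := psd_qform_pinv_bound (T_psd TX0).
  have [d d0 hd] := qform_bound H; exists (d * c); split; first by rewrite mulr_ge0// ltW.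
  exists X0 => // v; rewrite /re [X in _ * complex.Re X]PK//; last exact: T_psd.
  rewrite -complexReZ rmorphM -mulrA.
  apply: (@le_trans _ _ (complex.Re `|qform H (P *m v)|)).
    by apply: le_trans (ler_norm _) _; rewrite -lecR; have := normc_ge_Re (qform H (P *m v));
       move=> h; apply: le_trans h _; rewrite -ge0_complexE.
  apply: complexRe_le; apply: le_trans (hd _) _; apply: ler_wpM2l; [by rewrite ler0c ltW|exact: hc].
have lbE H : lbound (E H) 0 by move=> t [].
pose p H := inf (E H).
have p_le H t : E H t -> p H <= t by move=> h; apply: ge_inf => //; exists 0.
have le_p H z : (forall t, E H t -> z <= t) -> z <= p H by move=> h; exact: lb_le_inf.
have p_ge0 H : 0 <= p H by apply: (le_p) => t [].
have p_le0 H : (forall v, re H v <= 0) -> p H <= 0.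
  by move=> h; apply: (p_le); split=> //; exists X0 => // v; rewrite mul0r.
have p_scale (t : R) H : 0 < t -> p (t%:C *: H) <= t * p H.
  move=> t0; rewrite -ler_pdivrMl//; apply: (le_p) => s [s0 [X TX hX]].
  rewrite ler_pdivrMl//; apply: (p_le); split; first by rewrite mulr_ge0// ltW.
  by exists X => // v; rewrite reZ -mulrA ler_pM2l.
have sub_p : sublinear p.
  split=> [G H|t H].
    rewrite -lerBlDr; apply: (le_p) => t [t0 [X TX hX]].
    rewrite lerBlDr -lerBlDl; apply: (le_p) => s [s0 [Y TY hY]].
    rewrite lerBlDl; apply: (p_le); split; first exact: addr_ge0.
    have [Z TZ eZ] := mx_convex_cone T_convex TX TY t0 s0.
    by exists Z => // v; rewrite -reZ eZ !reD !reZ; exact: lerD.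
  rewrite le_eqVlt => /predU1P[<-|t0].
    rewrite scale0r mul0r; apply/eqP; rewrite eq_le p_ge0 p_le0// => v.
    by rewrite -(scale0r 0) reZ mul0r.
  apply/eqP; rewrite eq_le p_scale//= -ler_pdivlMl//.
  have := p_scale t^-1 (t%:C *: H).
  by rewrite scalerA -rmorphM mulVf ?gt_eqF// rmorph1 scale1r invr_gt0; exact.
have [W Wp WL] := hahn_banach_mx L sub_p.
(* For [c] equal to [-1], [i] or [-i], the form of [c v v^*] has real part at most 0, so its gauge
   is at most 0; the three resulting inequalities make [qform W v] real and nonnegative. *)
have W_psd : psd W.
  move=> v; rewrite -/(qform W v) -mxtrace_mul_rank1.
  pose H := v *m adjmx v.
  have trc c : \tr (W *m (c *: H)) = c * \tr (W *m H) by rewrite -scalemxAr mxtraceZ.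
  have bnd c : (forall x : R, 0 <= x -> complex.Re (c * x%:C) <= 0) ->
      complex.Re (c * \tr (W *m H)) <= 0.
    move=> hc; rewrite -trc; apply: le_trans (Wp _) (p_le0 _ _) => w.
    rewrite /re qformZ qform_rank1.
    have : 0 <= `|(adjmx v *m (P *m w)) 0 0| ^+ 2 by rewrite exprn_ge0.
    by move=> h; rewrite (ge0_complexE h); apply: hc; exact: complexRe_ge0.
  have := bnd (-1); have := bnd 'i%C; have := bnd (- 'i%C).
  rewrite -/H; case: (\tr (W *m H)) => a b /= h1 h2 h3.
  have ha : 0 <= a by have := h3 (fun x x0 => ltac:(simpl; lra)); lra.
  have hb : b <= 0 by have := h1 (fun x x0 => ltac:(simpl; lra)); lra.
  have hb' : 0 <= b by have := h2 (fun x x0 => ltac:(simpl; lra)); lra.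
  by rewrite lecE /= ha andbT; apply/eqP; lra.
(* Every [X] in [T] has gauge at most 1, so [W] is an admissible witness. *)
have L_rho : p L <= rho.
  rewrite -WL; apply: dual_bound => // X TX; apply: le_trans (Wp _) _.
  by apply: (p_le); split=> //; exists X => // v; rewrite mul1r.
have [|t [t0 [X TX hX]] tlt] := @inf_adherent _ (E L) delta delta0.
  by split => //; exists 0.
exists X, t; split; [exact: TX|exact: t0| |].
  by apply/ltW/(lt_le_trans tlt); rewrite lerD2r.
apply: psd_of_Re.
  by rewrite adjmxD adjmxN adjmxZ conjc_real (psd_hermitian (T_psd TX)) (psd_hermitian L_psd).
move=> v; rewrite qformD qformZ qformN complexReD complexReN complexReZ subr_ge0.
by have := hX v; rewrite /re (PK _ _ L_psd sL) (PK _ _ (T_psd TX) (sX _ TX)).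
Qed.
End Duality.
End ConeDuality.

(** * Channels, Choi operators and discrimination games *)

Section Channels.
Context {R : realType}.
Local Notation C := (R[i]).
Local Notation "x %:C" := (real_complex R x).

Lemma mxtrace_psd_ge0 n (A : 'M[C]_n) : psd A -> 0 <= \tr A.
Proof. by move=> hA; rewrite sumr_ge0// => i _; rewrite -mul_delta_qform; exact: hA. Qed.

Lemma mxtrace_mul_psd_ge0 n (A B : 'M[C]_n) : psd A -> psd B -> 0 <= \tr (A *m B).
Proof.
move=> /psd_gram[D ->] hB; rewrite mxtrace_mulC mulmxA mxtrace_mulC mulmxA.
by apply: mxtrace_psd_ge0; rewrite -{2}[D]adjmxK; exact: psd_congr.
Qed.

Lemma mx_blkP n d (X Y : 'M[C]_(n * d)) : (forall a b, blk X a b = blk Y a b) -> X = Y.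
Proof.
move=> h; apply/matrixP => i j.
case: (mxtens_indexP i) => a k; case: (mxtens_indexP j) => b l.
by have /matrixP/(_ k l) := h a b; rewrite !mxE.
Qed.

Lemma blkD n d (X Y : 'M[C]_(n * d)) a b : blk (X + Y) a b = blk X a b + blk Y a b.
Proof. by apply/matrixP => i j; rewrite !mxE. Qed.

Lemma blkZ n d c (X : 'M[C]_(n * d)) a b : blk (c *: X) a b = c *: blk X a b.
Proof. by apply/matrixP => i j; rewrite !mxE. Qed.

Lemma mxtrace_blk n d (X : 'M[C]_(n * d)) : \tr X = \sum_a \tr (blk X a a).
Proof.
rewrite /mxtrace (reindex (@mxtens_index n d)); last first.
  by apply: onW_bij; exists (@mxtens_unindex n d); [exact: mxtens_indexK|exact: mxtens_unindexK].
rewrite (pair_bigA _ (fun a i => blk X a a i i)) /=.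
by apply: eq_bigr => -[a i] _; rewrite mxE.
Qed.

Lemma blk_id_tensor n d1 d2 (G : 'M[C]_d1 -> 'M[C]_d2) (X : 'M[C]_(n * d1)) a b :
  blk (id_tensor G X) a b = G (blk X a b).
Proof.
apply/matrixP => i j; rewrite mxE /id_tensor summxE (bigD1 a)//= summxE (bigD1 b)//=.
rewrite tensmxE mxE !eqxx mul1r !big1 ?addr0// => [a' na|b' nb].
  by rewrite summxE big1// => b' _; rewrite tensmxE mxE eq_sym (negbTE na) mul0r.
by rewrite tensmxE mxE (eq_sym b) (negbTE nb) andbF mul0r.
Qed.

Lemma id_tensor_comb n d1 d2 (G H : 'M[C]_d1 -> 'M[C]_d2) c e (X : 'M[C]_(n * d1)) :
  id_tensor (fun Y => c *: G Y + e *: H Y) X = c *: id_tensor G X + e *: id_tensor H X.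
Proof. by apply: mx_blkP => a b; rewrite blkD !blkZ !blk_id_tensor. Qed.

Section LinearMaps.
Variables (d1 d2 : nat) (G : 'M[C]_d1 -> 'M[C]_d2).
Hypothesis G_linear : linear_map G.

Lemma linear_map0 : G 0 = 0.
Proof.
have := G_linear 1 0 0; rewrite !scale1r addr0 => /eqP.
by rewrite -subr_eq subrr eq_sym => /eqP.
Qed.

Lemma linear_mapZ c X : G (c *: X) = c *: G X.
Proof. by have := G_linear c X 0; rewrite linear_map0 !addr0. Qed.

Lemma linear_map_sum I (r : seq I) (F : I -> 'M[C]_d1) :
  G (\sum_(i <- r) F i) = \sum_(i <- r) G (F i).
Proof.
elim: r => [|i r IH]; first by rewrite !big_nil linear_map0.
by rewrite !big_cons -IH -[F i]scale1r G_linear !scale1r.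
Qed.

Lemma id_tensorZ n c (X : 'M[C]_(n * d1)) : id_tensor G (c *: X) = c *: id_tensor G X.
Proof. by apply: mx_blkP => a b; rewrite blkZ !blk_id_tensor blkZ linear_mapZ. Qed.
End LinearMaps.

(* The unnormalized maximally entangled operator, the sum of the [|aa><bb|]. *)
Definition maxent d : 'M[C]_(d * d) :=
  let phi : 'cV[C]_(d * d) := \col_k ((mxtens_unindex k).1 == (mxtens_unindex k).2)%:R in
  phi *m adjmx phi.

Definition choi d1 d2 (G : 'M[C]_d1 -> 'M[C]_d2) : 'M[C]_(d1 * d2) :=
  id_tensor G (maxent d1).

Lemma maxent_psd d : psd (maxent d).
Proof. exact: psd_gram_mul. Qed.

Lemma blk_maxent d a b : blk (maxent d) a b = delta_mx a b.
Proof.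
apply/matrixP => i j; rewrite !mxE big_ord1 !mxE !mxtens_indexK /= rmorph_nat -natrM mulnb.
by rewrite (eq_sym a) (eq_sym b).
Qed.

Lemma mxtrace_maxent d : \tr (maxent d) = d%:R.
Proof.
rewrite mxtrace_blk (eq_bigr (fun=> 1)) ?sumr_const ?card_ord// => a _.
rewrite blk_maxent /mxtrace (bigD1 a)//= mxE !eqxx big1 ?addr0// => i ia.
by rewrite mxE (negbTE ia).
Qed.

Lemma blk_choi d1 d2 (G : 'M[C]_d1 -> 'M[C]_d2) a b : blk (choi G) a b = G (delta_mx a b).
Proof. by rewrite blk_id_tensor blk_maxent. Qed.

Lemma choi_psd d1 d2 (G : 'M[C]_d1 -> 'M[C]_d2) : completely_positive G -> psd (choi G).
Proof. by apply; exact: maxent_psd. Qed.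

Lemma mxtrace_choi d1 d2 (G : 'M[C]_d1 -> 'M[C]_d2) : trace_preserving G -> \tr (choi G) = d1%:R.
Proof.
move=> hG; rewrite -mxtrace_maxent !mxtrace_blk; apply: eq_bigr => a _.
by rewrite blk_choi hG blk_maxent.
Qed.

Lemma choi_comb d1 d2 (G H : 'M[C]_d1 -> 'M[C]_d2) c e :
  choi (fun Y => c *: G Y + e *: H Y) = c *: choi G + e *: choi H.
Proof. exact: id_tensor_comb. Qed.

Lemma choiE d1 d2 (G : 'M[C]_d1 -> 'M[C]_d2) :
  choi G = \sum_i \sum_j (delta_mx i j *t G (delta_mx i j)).
Proof.
rewrite /choi /id_tensor; apply: eq_bigr => i _; apply: eq_bigr => j _.
by rewrite blk_maxent.
Qed.

Lemma delta_congrE n d (Y : 'M[C]_(n, d)) i j a b :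
  (Y *m delta_mx i j *m adjmx Y) a b = Y a i * conjc (Y b j).
Proof.
by rewrite -(mul_delta_mx (0 : 'I_1)) mulmxA -colE -mulmxA -rowE mxE big_ord1 !mxE.
Qed.

(* Choi's theorem: a Gram decomposition of the input turns [id (x) G] into a
   sum of congruences of the Choi operator. *)
Lemma completely_positive_choi d1 d2 (G : 'M[C]_d1 -> 'M[C]_d2) : linear_map G ->
  psd (choi G) -> completely_positive G.
Proof.
move=> hG pG n X /psd_gram[B ->].
(* Column [k] of [B], reshaped into a matrix. *)
pose Y k : 'M[C]_(n, d1) := \matrix_(a, i) B (mxtens_index (a, i)) k.
suff -> : id_tensor G (B *m adjmx B) =
    \sum_k (Y k *t 1%:M) *m choi G *m adjmx (Y k *t (1%:M : 'M[C]_d2)).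
  by apply: psd_sum => k; exact: psd_congr.
apply: mx_blkP => a b; rewrite blk_id_tensor.
have -> : blk (B *m adjmx B) a b =
    \sum_k \sum_i \sum_j (Y k a i * conjc (Y k b j)) *: delta_mx i j.
  apply/matrixP => i j; rewrite !mxE summxE; apply: eq_bigr => k _.
  rewrite summxE (bigD1 i)//= summxE (bigD1 j)//= !mxE !eqxx mulr1.
  rewrite !big1 ?addr0// => [i' ni|j' nj].
    by rewrite summxE big1// => j' _; rewrite !mxE (eq_sym i) (negbTE ni) mulr0.
  by rewrite !mxE (eq_sym j) (negbTE nj) andbF mulr0.
rewrite linear_map_sum//; apply/matrixP => s t; rewrite !mxE !summxE.
apply: eq_bigr => k _; rewrite linear_map_sum// choiE.
have -> : adjmx (Y k *t (1%:M : 'M[C]_d2)) = adjmx (Y k) *t 1%:M.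
  by rewrite /adjmx map_mxT trmx_tens map_mx1 trmx1.
rewrite mulmx_sumr mulmx_suml !summxE; apply: eq_bigr => i _.
rewrite linear_map_sum// mulmx_sumr mulmx_suml !summxE; apply: eq_bigr => j _.
rewrite linear_mapZ// !tensmx_mul mul1mx mulmx1 tensmxE [LHS]mxE; congr (_ * _).
by rewrite delta_congrE.
Qed.

Lemma psucc_comb d1 d2 (G H : 'M[C]_d1 -> 'M[C]_d2) (c s : R) m (p : 'I_m -> R) eta M :
  psucc (fun X => c%:C *: (G X + s%:C *: H X)) p eta M =
  c * (psucc G p eta M + s * psucc H p eta M).
Proof.
rewrite /psucc mulr_sumr -big_split /= mulr_sumr; apply: eq_bigr => i _.
have -> : id_tensor (fun X => c%:C *: (G X + s%:C *: H X)) (eta i) =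
    c%:C *: id_tensor G (eta i) + (c * s)%:C *: id_tensor H (eta i).
  rewrite -id_tensor_comb; congr id_tensor; apply/funext => X.
  by rewrite scalerDr scalerA -rmorphM.
rewrite mulmxDr -!scalemxAr mxtraceD !mxtraceZ complexReD !complexReZ; ring.
Qed.

Lemma psucc_ge0 d1 d2 (G : 'M[C]_d1 -> 'M[C]_d2) m (p : 'I_m -> R) eta M :
  completely_positive G -> is_ensemble p eta -> is_povm M -> 0 <= psucc G p eta M.
Proof.
move=> cG [p0 _ etaD] [M0 _]; rewrite sumr_ge0// => i _; rewrite mulr_ge0//.
by apply/complexRe_ge0/mxtrace_mul_psd_ge0 => //; apply: cG; have [] := etaD i.
Qed.

(* Measuring the normalized maximally entangled state with the two-outcome
   POVM [(W / c, 1 - W / c)], where the second preparation has probability 0. *)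
Lemma psd_game d1 d2 (W : 'M[C]_(d1 * d2)) : (0 < d1)%N -> psd W ->
  exists2 k : R, 0 < k & exists (m : nat) (p : 'I_m -> R) eta (M : 'I_m -> 'M[C]_(d1 * d2)),
    [/\ is_ensemble p eta, is_povm M & forall G, linear_map G ->
        psucc G p eta M = k * complex.Re (\tr (W *m choi G))].
Proof.
move=> d1_gt0 hW; have [c c0 hc] := psd_qform_bound hW.
have d0 : 0 < d1%:R :> R by rewrite ltr0n.
(* The factor [c^-1] brings [W] below the identity, and [d1^-1] normalizes the maximally entangled
   operator. *)
exists (c^-1 * d1%:R^-1); first by rewrite mulr_gt0// invr_gt0.
exists 2%N, (fun i => (i == 0)%:R), (fun=> (d1%:R^-1)%:C *: maxent d1),
  (fun i => if i == 0 then (c^-1)%:C *: W else 1%:M - (c^-1)%:C *: W); split.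
- split=> [i||_]; first exact: ler0n.
    by rewrite big_ord_recl big_ord1 /= addr0.
  split; first by apply: psdZ; [rewrite ler0c invr_ge0 ltW|exact: maxent_psd].
  by rewrite mxtraceZ mxtrace_maxent -(rmorph_nat (real_complex R)) -rmorphM mulVf ?gt_eqF.
- split=> [i|]; last by rewrite big_ord_recl big_ord1 /= addrC subrK.
  have cV : 0 <= (c^-1)%:C by rewrite ler0c invr_ge0 ltW.
  case: eqP => _; first exact: psdZ.
  move=> v; rewrite -/(qform _ v) qformD qformN qformZ subr_ge0 qform1.
  apply: le_trans (ler_wpM2l cV (hc v)) _.
  by rewrite mulrA -rmorphM mulVf ?gt_eqF// rmorph1 mul1r.
move=> G hG; rewrite /psucc big_ord_recl big_ord1 /= mul1r mul0r addr0.
by rewrite id_tensorZ// -scalemxAl -scalemxAr scalerA -rmorphM mxtraceZ complexReZ.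
Qed.

End Channels.

(** * Success ratios and robustness for one convex class *)

Section RobustnessDuality.
Context {R : realType}.
Local Notation C := (R[i]).
Local Notation "x %:C" := (real_complex R x).
Variables d1 d2 : nat.
Implicit Types (S : set ('M[C]_d1 -> 'M[C]_d2)) (G Lam Th : 'M[C]_d1 -> 'M[C]_d2).

Definition mixture Lam Th (s : R) : 'M[C]_d1 -> 'M[C]_d2 :=
  fun X => ((1 + s)^-1)%:C *: (Lam X + s%:C *: Th X).

(** The success of the mixture, times [1 + s], is that of [Lam] plus [s] times that of [Th], and the
    latter is nonnegative. *)
Lemma max_ratio_le_mixture S Lam Th (s : R) : is_channel Th -> 0 <= s ->
  S (mixture Lam Th s) -> (max_ratio Lam S <= (1 + s)%:E)%E.
Proof.
move=> [_ cTh _] s0 Smix; have s1 : 0 < 1 + s by rewrite ltr_pwDl.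
apply: ge_ereal_sup => _ [m [p [eta [M [he hM ->]]]]].
have le_mix : psucc Lam p eta M <= (1 + s) * psucc (mixture Lam Th s) p eta M.
  rewrite psucc_comb mulrA divff ?gt_eqF// mul1r lerDl.
  by rewrite mulr_ge0//; exact: psucc_ge0.
have : ((psucc (mixture Lam Th s) p eta M)%:E <= max_psucc S p eta M)%E.
  by apply: ereal_sup_ubound; exists (mixture Lam Th s).
(* The supremum dominates a real number, so it is not [-oo]; at [+oo] the quotient is 0 by
   convention. *)
rewrite /eratio; case: max_psucc => [r| |] //; last by rewrite lee_fin (ltW s1).
rewrite lee_fin => le_r.
have le_sr : psucc Lam p eta M <= (1 + s) * r.
  by apply: le_trans le_mix _; rewrite ler_pM2l.
case: ltP => r0; first by rewrite lee_fin ler_pdivrMr.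
rewrite ltNge (le_trans le_sr) ?lee_fin ?(ltW s1)//.
by rewrite pmulr_rle0.
Qed.

(** A real bound rules out the quotient [+oo]: if the denominator is not positive, the numerator
    must be 0. *)
Lemma ereal_le_of_eratio (a k rho : R) b : 0 <= a -> 0 < k -> (b <= k%:E)%E ->
  (eratio a b <= rho%:E)%E -> a <= rho * k.
Proof.
move=> a0 k0; have notpos : ((if (0 < a)%R then +oo else 0) <= rho%:E)%E -> a <= rho * k.
  case: ltP => // a_le0; rewrite lee_fin => rho0.
  by apply: le_trans a_le0 _; rewrite mulr_ge0// ltW.
case: b => [r| |] //=; rewrite lee_fin => rk; case: ltP => // r0.
rewrite lee_fin => h; have rho0 : 0 <= rho by apply: le_trans h; rewrite divr_ge0// ltW.
by move: h; rewrite ler_pdivrMr// => /le_trans; apply; rewrite ler_wpM2l.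
Qed.

Lemma mixture_of_choi_le G Lam (s : R) : is_channel G -> is_channel Lam -> 0 < s ->
  psd ((1 + s)%:C *: choi G - choi Lam) ->
  exists2 Th, is_channel Th & mixture Lam Th s = G.
Proof.
move=> [lG cG tG] [lL cL tL] s0 hpsd.
have s1 : 0 < 1 + s by rewrite ltr_wpDl.
(* Solve [G = (Lam + s Th) / (1 + s)] for [Th]; Choi's theorem gives complete positivity, and the
   coefficients sum to 1. *)
pose Th : 'M[C]_d1 -> 'M[C]_d2 := fun X => (s^-1 * (1 + s))%:C *: G X + (- s^-1)%:C *: Lam X.
have lTh : linear_map Th.
  move=> c X Y; rewrite /Th lG lL !scalerDr !scalerA ![_ * c]mulrC addrACA.
  by rewrite -!scalerA.
exists Th; first split; first exact: lTh.
- apply: completely_positive_choi => //; rewrite choi_comb.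
  have -> : (s^-1 * (1 + s))%:C *: choi G + (- s^-1)%:C *: choi Lam =
      (s^-1)%:C *: ((1 + s)%:C *: choi G - choi Lam).
    by rewrite scalerBr scalerA -rmorphM rmorphN scaleNr.
  by apply: psdZ hpsd; rewrite ler0c invr_ge0 ltW.
- move=> X; rewrite /Th mxtraceD !mxtraceZ tG tL -mulrDl -rmorphD.
  have -> : s^-1 * (1 + s) - s^-1 = 1 by rewrite mulrDr mulr1 mulVf ?gt_eqF//; ring.
  by rewrite rmorph1 mul1r.
apply/funext => X; rewrite /mixture /Th [s%:C *: _]scalerDr !scalerA -!rmorphM.
have -> : s * (s^-1 * (1 + s)) = 1 + s by rewrite mulrA divff ?gt_eqF ?mul1r.
have -> : s * - s^-1 = -1 by rewrite mulrN divff ?gt_eqF.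
rewrite rmorphN rmorph1 scaleN1r [Lam X + _]addrC subrK scalerA -rmorphM.
by rewrite mulVf ?gt_eqF// rmorph1 scale1r.
Qed.

(** Cone duality is applied to the Choi operators of [S]. Half of [delta] pays for an infimum that
    may not be attained, the other half makes [s] positive, so that one can divide by it. *)
Lemma mixture_of_max_ratio_le S Lam (rho delta : R) : (0 < d1)%N ->
  (forall G, S G -> is_channel G) -> convex_channels S -> is_channel Lam ->
  (max_ratio Lam S <= rho%:E)%E -> 0 < delta ->
  exists s, [/\ 0 <= s, s <= rho - 1 + delta &
    exists2 Th, is_channel Th & S (mixture Lam Th s)].
Proof.
move=> d1_gt0 S_chan S_conv Lam_chan ratio_le delta0; have [lL cL tL] := Lam_chan.
pose T := [set choi G | G in S].
have T_conv : mx_convex T.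
  move=> _ _ t [G SG <-] [H SH <-] t01; exists (fun X => t%:C *: G X + (1 - t)%:C *: H X).
    exact: S_conv.
  exact: choi_comb.
have T_psd X : T X -> psd X by move=> [G /S_chan[_ cG _] <-]; exact: choi_psd.
(* In the game built from [W], every channel of [S] succeeds with probability at most [k], and [Lam]
   with [k] times the trace pairing, so the ratio bound applies. *)
have dual W : psd W -> (forall X, T X -> complex.Re (\tr (W *m X)) <= 1) ->
    complex.Re (\tr (W *m choi Lam)) <= rho.
  move=> hW WT; have [k k0 [m [p [eta [M [he hM game]]]]]] := psd_game d1_gt0 hW.
  rewrite -(ler_pM2l k0) -game// [k * _]mulrC.
  apply: (@ereal_le_of_eratio _ _ _ (max_psucc S p eta M)) => //.
  - exact: psucc_ge0.
  - apply: ge_ereal_sup => _ [G SG <-]; have [lG _ _] := S_chan _ SG.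
    by rewrite lee_fin game// -[leRHS]mulr1 ler_pM2l// WT//; exists G.
  - by apply: le_trans ratio_le; apply: ereal_sup_ubound; exists m, p, eta, M.
have trL := mxtrace_choi tL.
have d1_ge1 : 1 <= d1%:R :> R by rewrite ler1n.
have Re_nat n : complex.Re (n%:R : C) = n%:R by rewrite -(rmorph_nat (real_complex R)).
(* If [S] were empty, every positive operator would be a witness; the multiple [|rho| + 1] of the
   identity pairs with [choi Lam] to [(|rho| + 1) d1 > rho]. *)
have T_neq0 : T !=set0.
  apply/set0P/negP => /eqP T0.
  have x0 : 0 < `|rho| + 1 by rewrite ltr_wpDl.
  have : psd ((`|rho| + 1)%:C *: (1%:M : 'M[C]_(d1 * d2))).
    apply: psdZ; first by rewrite ler0c ltW.
    by move=> v; rewrite -/(qform _ v) qform1; exact: sqnorm_ge0.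
  move=> /dual; rewrite T0 => /(_ (fun X (h : False) => match h with end)).
  rewrite -scalemxAl mul1mx mxtraceZ trL complexReZ Re_nat leNgt => /negP; apply.
  apply: le_lt_trans (ler_norm _) _; apply: (@lt_le_trans _ _ (`|rho| + 1)); first by rewrite ltrDl.
  by rewrite ler_peMr// ltW.
have delta2 : 0 < delta / 2 by rewrite divr_gt0.
have [_ [t [[G SG <-] t0 t_le hpsd]]] :=
  cone_duality T_conv T_psd (choi_psd cL) dual T_neq0 delta2.
have [lG cG tG] := S_chan _ SG.
(* Compare traces: the difference is positive and both Choi operators have trace [d1]. *)
have t1 : 1 <= t.
  have := complexRe_ge0 (mxtrace_psd_ge0 hpsd).
  rewrite -scaleN1r mxtraceD !mxtraceZ mulN1r (mxtrace_choi tG) trL complexReD complexReN complexReZ.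
  by rewrite Re_nat subr_ge0 ler_pMl// (lt_le_trans ltr01).
pose s := t + delta / 2 - 1.
have s0 : 0 < s by rewrite /s subr_gt0 (le_lt_trans t1)// ltrDl.
have [|Th Th_chan eG] := mixture_of_choi_le (S_chan _ SG) Lam_chan s0.
  have -> : (1 + s)%:C *: choi G - choi Lam = (delta / 2)%:C *: choi G + (t%:C *: choi G - choi Lam).
    have -> : 1 + s = delta / 2 + t by rewrite /s; ring.
    by rewrite rmorphD scalerDl -addrA.
  by apply: psdD hpsd; apply: psdZ (choi_psd cG); rewrite ler0c ltW.
exists s; split; [exact: ltW|rewrite /s; lra|].
by exists Th => //; rewrite eG.
Qed.

End RobustnessDuality.

(** * Passage from one convex class to the union of the classes *)

Theorem theorem15 (R : realType) (d1 d2 : nat) (d1_gt0 : (0 < d1)%N) (d2_gt0 : (0 < d2)%N)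
  (K : Type) (OF : K -> set ('M[R[i]]_d1 -> 'M[R[i]]_d2))
  (OF_channels : forall k G, OF k G -> is_channel G)
  (OF_convex : forall k, convex_channels (OF k))
  (Lam : 'M[R[i]]_d1 -> 'M[R[i]]_d2) (Lam_channel : is_channel Lam)
  (Lam_not_free : ~ (exists k, OF k Lam)) :
  ereal_inf [set max_ratio Lam (OF k) | k in [set: K]] =
  (1 + gen_robustness (fun G => exists k, OF k G) Lam)%E.
Proof.
apply/eqP; rewrite eq_le; apply/andP; split.
  (* A free mixture lies in some class [k], whose ratio it bounds by [1 + s]. *)
  rewrite -leeBlDl//; apply: le_ereal_inf_tmp => _ [s [s0 [Th [Th_chan [k OFmix]]]] <-].
  rewrite leeBlDl// -EFinD; apply: le_trans (max_ratio_le_mixture Th_chan s0 OFmix).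
  by apply: ereal_inf_lbound; exists k.
apply: le_ereal_inf_tmp => _ [k _ <-].
have robust_le rho : (max_ratio Lam (OF k) <= rho%:E)%E ->
    (1 + gen_robustness (fun G => exists k, OF k G) Lam <= rho%:E)%E.
  (* Letting the slack [e] tend to 0 bounds the robustness by [rho - 1]. *)
  move=> le_rho; rewrite -[rho](subrKC 1) EFinD leeD2l//; apply/lee_addgt0Pr => e e0.
  have [s [s0 s_le [Th Th_chan mix]]] :=
    mixture_of_max_ratio_le d1_gt0 (OF_channels k) (OF_convex k) Lam_channel le_rho e0.
  rewrite -EFinD; apply: (@le_trans _ _ s%:E); last by rewrite lee_fin.
  by apply: ereal_inf_lbound; exists s => //; split=> //; exists Th; split=> //; exists k.
case E : (max_ratio Lam (OF k)) => [rho| |]; last 2 first.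
- by rewrite leey.
(* With [rho = 0] and slack 1/2, a ratio of [-oo] would give [0 <= s <= -1/2]. *)
- have half_gt0 : 0 < 2^-1 :> R by rewrite invr_gt0.
  have [|s [s0 s_le _]] := mixture_of_max_ratio_le (rho := 0) d1_gt0
    (OF_channels k) (OF_convex k) Lam_channel _ half_gt0; first by rewrite E leNye.
  by exfalso; clear -s0 s_le; lra.
by apply: robust_le; rewrite E.
Qed.
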